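(* Let $(p,l)\in\Psi_1^{\rm irr}$ with $\Delta_{(p,l)}\neq0$. The $p$-adic zeta function $\zeta_{p,l}:\mathbb{Z}_p\to\mathbb{Z}_p$ has a unique zero, at $s=\chi_{(p,l)}$.
   Context: $B_n$ denotes the Bernoulli numbers, $\frac{z}{e^z-1}=\sum_{n\ge0}B_n\frac{z^n}{n!}$, and $\widehat{B}(n)=B_n/n$; $\varphi$ is Euler's totient function. For rational $q$ and a positive integer $m$, $m\mid q$ means that $m$ divides the numerator of $q$ in lowest terms. For $n\ge1$, $\Psi_n^{\rm irr}$ is the set of pairs $(p,l)$ with $p$ an odd prime, $l$ even, $2\le l<\varphi(p^n)$ and $p^n\mid\widehat{B}(l)$. For $(p,l)\in\Psi_1^{\rm irr}$, $\Delta_{(p,l)}$ is the integer with $0\le\Delta_{(p,l)}<p$ and $\Delta_{(p,l)}\equiv p^{-1}\left(\widehat{B}(l+p-1)-\widehat{B}(l)\right)\pmod p$. If $(p,l)\in\Psi_1^{\rm irr}$ and $\Delta_{(p,l)}\ne0$, then (known) for each $n\ge1$ there is exactly one $(p,l_n)\in\Psi_n^{\rm irr}$ with $l_n\equiv l\pmod{p-1}$, and there are unique digits $0\le s_\nu<p$ ($\nu\ge2$) with $l_n=l+(p-1)\sum_{\nu=0}^{n-2}s_{\nu+2}p^\nu$ for all $n\ge1$. Define $\chi_{(p,l)}=\sum_{\nu\ge0}s_{\nu+2}\,p^\nu\in\mathbb{Z}_p$. For $n\ge2$ put $\zeta_p(1-n)=(1-p^{n-1})\zeta(1-n)=-(1-p^{n-1})B_n/n$.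 For a prime $p\ge5$ and $s_1\in\{2,4,\ldots,p-3\}$, $\zeta_{p,s_1}:\mathbb{Z}_p\to\mathbb{Z}_p$ is defined by $\zeta_{p,s_1}(s)=\lim_{t_\nu\to s}\zeta_p(1-(s_1+(p-1)t_\nu))$ for any sequence $(t_\nu)$ of nonnegative integers converging $p$-adically to $s$; by the Kummer congruences this is well defined and continuous. *)

(* Defs.v *)
From HB Require Import structures.
From mathcomp Require Import all_boot all_order all_algebra.
From mathcomp Require Import boolp classical_sets.

Set Implicit Arguments.
Unset Strict Implicit.
Unset Printing Implicit Defensive.

Import Order.TTheory GRing.Theory Num.Theory.
Local Open Scope ring_scope.

(* The list [:: B_0; ...; B_(n-1)]; each term solves the coefficient of
   z^(m+1) in (e^z - 1) * \sum_k B_k z^k / k! = z. *)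
Fixpoint bernoulli_seq (n : nat) : seq rat :=
  if n is m.+1 then
    let s := bernoulli_seq m in
    rcons s (m`!%:R * ((m == 0%N)%:R - \sum_(i < m) s`_i / i`!%:R / (m.+1 - i)`!%:R))
  else [::].

Definition bernoulli (n : nat) : rat := (bernoulli_seq n.+1)`_n.

Lemma size_bernoulli_seq n : size (bernoulli_seq n) = n.
Proof. by elim: n => //= n IHn; rewrite size_rcons IHn. Qed.

Lemma nth_bernoulli_seq n i : (i < n)%N -> (bernoulli_seq n)`_i = bernoulli i.
Proof.
elim: n => // n IHn; rewrite ltnS leq_eqVlt => /orP[/eqP-> //|lt_in].
by rewrite /= nth_rcons size_bernoulli_seq lt_in IHn.
Qed.

Definition exp_sub1_coef (n : nat) : rat := if n is 0 then 0 else n`!%:R^-1.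

(* z / (e^z - 1) = \sum_n B_n z^n / n!, as the Cauchy product identity
   (\sum_n B_n z^n / n!) * (e^z - 1) = z between coefficients of z^n. *)
Lemma bernoulli_generating_function n :
  \sum_(i < n.+1) bernoulli i / i`!%:R * exp_sub1_coef (n - i) = (n == 1%N)%:R.
Proof.
have fact_neq0 m : (m`!%:R : rat) != 0 by rewrite pnatr_eq0 -lt0n fact_gt0.
case: n => [|n]; first by rewrite big_ord_recr big_ord0 /= mulr0 addr0.
rewrite big_ord_recr /= subnn mulr0 addr0 big_ord_recr /= subSnn.
rewrite [exp_sub1_coef 1]invr1 mulr1 [bernoulli n]/bernoulli /=.
rewrite nth_rcons size_bernoulli_seq ltnn eqxx mulrC mulKf // eqSS.
rewrite [X in X + (_ - _)](_ : _ = \sum_(i < n)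
  (bernoulli_seq n)`_i / i`!%:R / (n.+1 - i)`!%:R); first by rewrite addrC subrK.
apply: eq_bigr => i _.
by rewrite nth_bernoulli_seq // subSn // ltnW.
Qed.

Definition bernoulli_hat (n : nat) : rat := bernoulli n / n%:R.

(* [numq q] is the numerator of q in lowest terms. *)
Definition dvdq (m : nat) (q : rat) : bool := (m%:Z %| numq q)%Z.

Definition Psi_irr (n : nat) : pred (nat * nat) :=
  [pred pl | [&& prime pl.1, odd pl.1, ~~ odd pl.2,
                 (2 <= pl.2)%N, (pl.2 < totient (pl.1 ^ n))%N
               & dvdq (pl.1 ^ n) (bernoulli_hat pl.2)]].

Definition Delta (p l : nat) : nat :=
  xget 0%N [set d : nat | (d < p)%N /\
    dvdq p (p%:R^-1 * (bernoulli_hat (l + p - 1) - bernoulli_hat l) - d%:R)].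

(* The ring Z_p as the inverse limit of the Z / p^n; [residue x n] is the
   representative in [0, p^n) of x modulo p^n. *)
Record padic_int (p : nat) := PadicInt {
  residue : nat -> nat;
  residue_compat : forall n, residue n = (residue n.+1 %% p ^ n)%N
}.

HB.instance Definition _ (p : nat) := gen_eqMixin (padic_int p).
HB.instance Definition _ (p : nat) := gen_choiceMixin (padic_int p).

Lemma padic_int_ext (p : nat) (x y : padic_int p) :
  residue x =1 residue y -> x = y.
Proof.
case: x y => [f Hf] [g Hg] /= /funext fg; subst g.
by rewrite (Prop_irrelevance Hf Hg).
Qed.

Lemma residue_lt (p : nat) (x : padic_int p) n :
  (0 < p)%N -> (residue x n < p ^ n)%N.
Proof. by move=> p0; rewrite residue_compat ltn_pmod // expn_gt0 p0. Qed.

Lemma padic_of_nat_subproof (p m n : nat) :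
  (m %% p ^ n)%N = (m %% p ^ n.+1 %% p ^ n)%N.
Proof. by rewrite modn_dvdm // expnS dvdn_mull. Qed.

Definition padic_of_nat (p m : nat) : padic_int p :=
  PadicInt (padic_of_nat_subproof p m).

(* Convergence in Q_p of a sequence of rationals to a p-adic integer: since
   x is [residue x k] modulo p^k, |u_i - x|_p <= p^-k amounts to p^k dividing
   u_i - residue x k. *)
Definition padic_cvg (p : nat) (u : nat -> rat) (x : padic_int p) : Prop :=
  forall k : nat, exists N : nat, forall i : nat, (N <= i)%N ->
    dvdq (p ^ k) (u i - (residue x k)%:R).

Definition chi_partial_sum (p : nat) (s : nat -> nat) (m : nat) : nat :=
  (\sum_(0 <= nu < m) s nu.+2 * p ^ nu)%N.

Definition chi_digits (p l : nat) (s : nat -> nat) : Prop :=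
  (forall nu, (2 <= nu)%N -> (s nu < p)%N) /\
  (forall n, (1 <= n)%N ->
     (p, l + (p - 1) * chi_partial_sum p s (n - 1))%N \in Psi_irr n).

(* Junk value 0 when no digit sequence exists. *)
Definition chi (p l : nat) : padic_int p :=
  xget (padic_of_nat p 0) [set x : padic_int p | exists s : nat -> nat,
    chi_digits p l s /\ padic_cvg (fun m => (chi_partial_sum p s m)%:R) x].

(* [zetap_neg p n] is zeta_p(1 - n) = - (1 - p^(n-1)) B_n / n, for n >= 2. *)
Definition zetap_neg (p n : nat) : rat :=
  - ((1 - p%:R ^+ (n - 1)) * bernoulli_hat n).

(* Junk value 1 when the limit does not exist: a junk value 0 would create
   spurious zeros. *)
Definition padic_zeta (p s1 : nat) (s : padic_int p) : padic_int p :=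
  xget (padic_of_nat p 1) [set y : padic_int p | forall t : nat -> nat,
    padic_cvg (fun i => (t i)%:R) s ->
    padic_cvg (fun i => zetap_neg p (s1 + (p - 1) * t i)) y].

Arguments padic_zeta : clear implicits.

(* Main.v *)
(* Write F(t) = zeta_p(1 - (l + (p - 1) t)) for natural numbers t.  Since
   B_n is the p-adic limit of p^-M \sum_(j < p^M) j^n, comparing j |-> j^n with
   j |-> (a j mod p^M)^n (Voronoi) shows that -(a^n - 1) zeta_p(1 - n) is the
   limit of the sums of (a j)^(n-1) floor(a j / p^M) over the j < p^M prime
   to p.  Choosing a close to a root of unity in Z_p with a^l <> 1 mod p, the
   factor a^n - 1 becomes independent of t, so that modulo any power of p, F
   is a combination of exponentials u^t with u = 1 mod p.  These satisfy
   u^(t+k) - u^t = k (u - 1) mod p^(v+2) whenever p^v divides k, hence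
     F(t + k) - F(t) = k (F(1) - F(0)) = - k p Delta mod p^(v+2).
   As Delta is a p-unit and p divides F(0), a Hensel argument gives a unique
   p-adic zero of F, whose digits are those of chi.  The existence of the
   limit defining zeta_(p,l) is never needed away from chi: where it does not
   exist, [padic_zeta] has the nonzero junk value 1. *)

Require Import Defs.
From HB Require Import structures.
From mathcomp Require Import all_boot all_order all_algebra.
From mathcomp Require Import boolp classical_sets.
From mathcomp Require Import cyclic ring zify.

Set Implicit Arguments.
Unset Strict Implicit.
Unset Printing Implicit Defensive.

Import Order.TTheory GRing.Theory Num.Theory.
Local Open Scope ring_scope.

(** * Divisibility by powers of p in Z_(p) *)

(* [q] is divisible by [p ^ k] in the localization of Z at [p]; unlike [dvdq],
   this entails that [q] is [p]-integral also when [k = 0]. *)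
Definition local_dvd (p k : nat) (q : rat) : Prop :=
  exists d : nat, exists2 z : int, coprime d p & d%:R * q = p%:R ^+ k * z%:~R.

Section LocalDvd.

Variable p : nat.
Implicit Types (k : nat) (q : rat).

Lemma local_dvd_int k (z : int) : local_dvd p k (p%:R ^+ k * z%:~R).
Proof. by exists 1%N, z; rewrite ?coprime1n // mul1r. Qed.

Lemma local_dvd0 k : local_dvd p k 0.
Proof. by exists 1%N, 0; rewrite ?coprime1n // mulr0z !mulr0. Qed.

Lemma local_dvdD k q r :
  local_dvd p k q -> local_dvd p k r -> local_dvd p k (q + r).
Proof.
move=> [d [z cd dq]] [e [y ce er]].
exists (d * e)%N, (z * e%:Z + y * d%:Z); first by rewrite coprimeMl cd.
rewrite natrM [LHS](_ : _ = e%:R * (d%:R * q) + d%:R * (e%:R * r)); last by ring.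
by rewrite dq er rmorphD !rmorphM /= -!pmulrn; ring.
Qed.

Lemma local_dvdM j k q r :
  local_dvd p j q -> local_dvd p k r -> local_dvd p (j + k) (q * r).
Proof.
move=> [d [z cd dq]] [e [y ce er]].
exists (d * e)%N, (z * y); first by rewrite coprimeMl cd.
by rewrite natrM mulrACA dq er rmorphM exprD /=; ring.
Qed.

Lemma local_dvd_intr (z : int) : local_dvd p 0 z%:~R.
Proof. by have := local_dvd_int 0 z; rewrite expr0 mul1r. Qed.

Lemma local_dvd_natr n : local_dvd p 0 n%:R.
Proof. exact: (local_dvd_intr n). Qed.

Lemma local_dvd_expp k : local_dvd p k (p%:R ^+ k).
Proof. by have := local_dvd_int k 1; rewrite mulr1. Qed.

Lemma local_dvdMl k q r :
  local_dvd p 0 q -> local_dvd p k r -> local_dvd p k (q * r).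
Proof. by move=> Hq /(local_dvdM Hq). Qed.

Lemma local_dvdMr k q r :
  local_dvd p k q -> local_dvd p 0 r -> local_dvd p k (q * r).
Proof. by move=> Hq Hr; rewrite mulrC; exact: local_dvdMl. Qed.

Lemma local_dvdN k q : local_dvd p k q -> local_dvd p k (- q).
Proof. by rewrite -mulN1r; apply/local_dvdMl/(local_dvd_intr (-1)). Qed.

Lemma local_dvdB k q r :
  local_dvd p k q -> local_dvd p k r -> local_dvd p k (q - r).
Proof. by move=> Hq /local_dvdN; exact: local_dvdD. Qed.

Lemma local_dvd_sum k (I : Type) (s : seq I) (P : pred I) (f : I -> rat) :
  (forall i, P i -> local_dvd p k (f i)) ->
  local_dvd p k (\sum_(i <- s | P i) f i).
Proof. by apply: big_ind; [exact: local_dvd0 | exact: local_dvdD]. Qed.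

Lemma local_dvdW j k q : (j <= k)%N -> local_dvd p k q -> local_dvd p j q.
Proof.
move=> jk [d [z cd dq]]; exists d, (p%:Z ^+ (k - j) * z) => //.
by rewrite dq rmorphM rmorphXn /= -pmulrn mulrA -exprD subnKC.
Qed.

Lemma local_dvd_unit k d q :
  coprime d p -> local_dvd p k (d%:R * q) -> local_dvd p k q.
Proof.
move=> cd [e [z ce eq]]; exists (e * d)%N, z; first by rewrite coprimeMl ce.
by rewrite natrM -mulrA.
Qed.

Lemma local_dvd_congr k q r :
  local_dvd p k (q - r) -> local_dvd p k r -> local_dvd p k q.
Proof. by move=> /local_dvdD h/h; rewrite subrK. Qed.

Hypothesis p_prime : prime p.

Let p_gt0 : (0 < p)%N. Proof. exact: prime_gt0. Qed.

Let pk_neq0 k : (p%:R ^+ k : rat) != 0.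
Proof. by rewrite expf_neq0 // pnatr_eq0 -lt0n. Qed.

Lemma local_dvd_pM j k q : local_dvd p (j + k) (p%:R ^+ j * q) -> local_dvd p k q.
Proof.
move=> [d [z cd dq]]; exists d, z => //.
by apply: (mulfI (pk_neq0 j)); rewrite mulrCA dq exprD mulrA.
Qed.

(** Cancelling [n] costs [logn p n] powers of [p]; the remaining cofactor is a [p]-unit. *)
Lemma local_dvd_natM k n q : (0 < n)%N ->
  local_dvd p (logn p n + k) (n%:R * q) -> local_dvd p k q.
Proof.
move=> n_gt0; have [m pm def_n] := pfactor_coprime p_prime n_gt0.
rewrite {2}def_n mulnC natrM natrX -mulrA => /local_dvd_pM.
by apply: local_dvd_unit; rewrite coprime_sym.
Qed.

Lemma local_dvd_intE k (z : int) :
  local_dvd p k z%:~R <-> (p%:Z ^+ k %| z)%Z.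
Proof.
split=> [[d [y cd]]|/dvdzP[y ->]]; last first.
  by rewrite mulrC rmorphM rmorphXn /= -pmulrn; exact: local_dvd_int.
move=> dz; have {}dz : d%:Z * z = p%:Z ^+ k * y.
  by apply: (@intr_inj rat); rewrite !rmorphM rmorphXn /= -!pmulrn.
rewrite -(@Gauss_dvdzr _ d%:Z); first by rewrite dz dvdz_mulr.
by rewrite coprimezXl // /coprimez /gcdz /= eqz_nat gcdnC.
Qed.

Lemma local_dvd_natE k (m n : nat) :
  local_dvd p k (m%:R - n%:R) <-> m = n %[mod p ^ k].
Proof.
have -> : m%:R - n%:R = (m%:Z - n%:Z)%:~R :> rat by rewrite rmorphB /= -!pmulrn.
rewrite local_dvd_intE (_ : p%:Z ^+ k = (p ^ k)%N); last first.
  by rewrite -[RHS]natz natrX natz.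
rewrite -eqz_mod_dvd !modz_nat eqz_nat.
by split=> [/eqP|->].
Qed.

Lemma local_dvd_natrE k n : local_dvd p k n%:R <-> (p ^ k %| n)%N.
Proof.
have := local_dvd_natE k n 0; rewrite subr0 => ->.
by rewrite mod0n /dvdn; split=> [->|/eqP].
Qed.

Lemma local_dvd_dvdq k q : local_dvd p k q -> dvdq (p ^ k) q.
Proof.
move=> [d [z cd dq]].
have : local_dvd p k (numq q)%:~R.
  exists d, (z * denq q) => //.
  by rewrite rmorphM /= mulrA -dq numqE mulrA.
by rewrite local_dvd_intE /dvdq !dvdzE abszX.
Qed.

(** Once [p] divides the numerator, lowest terms keep [p] out of the denominator. For [k = 0],
    [dvdq] holds of every rational, hence the condition on [k]. *)
Lemma dvdq_local_dvd k q : (0 < k)%N -> dvdq (p ^ k) q -> local_dvd p k q.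
Proof.
move=> k_gt0 /dvdzP[z def_n]; exists `|denq q|%N, z.
  have : (p %| `|numq q|)%N.
    by rewrite def_n abszM /= -(prednK k_gt0) expnS dvdn_mull // dvdn_mulr.
  move=> /dvdnP[m def_m]; have := coprime_num_den q.
  by rewrite def_m coprimeMl coprime_sym [coprime p _]coprime_sym => /andP[].
have -> : (`|denq q|%N)%:R = (denq q)%:~R :> rat.
  by rewrite pmulrn absz_denq.
by rewrite mulrC -numqE def_n rmorphM /= -pmulrn natrX mulrC.
Qed.

End LocalDvd.

(** * Power sums and Bernoulli numbers *)

Lemma factr_neq0 n : (n`!%:R : rat) != 0.
Proof. by rewrite pnatr_eq0 -lt0n fact_gt0. Qed.

(** This compares the coefficients of z^k in e^((x+1)z) = e^(xz) e^z. *)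
Lemma exp_taylor_shift (x : rat) k :
  (x + 1) ^+ k / k`!%:R = \sum_(i < k.+1) x ^+ i / i`!%:R / (k - i)`!%:R.
Proof.
rewrite addrC exprDn mulr_suml; apply: eq_bigr => i _.
rewrite expr1n mul1r -(@bin_fact k i) -1?ltnS // !natrM -mulr_natr.
rewrite -mulrA -mulrA; congr (_ * _).
have bin_neq0 : ('C(k, i)%:R : rat) != 0 by rewrite pnatr_eq0 -lt0n bin_gt0 -ltnS.
by field; rewrite bin_neq0 !factr_neq0.
Qed.

(** Induction on [N]: the increment of the right side is a convolution of Bernoulli numbers with the
    coefficients of e^z - 1, which the generating function evaluates. *)
Lemma faulhaber n N :
  \sum_(j < N) (j%:R : rat) ^+ n =
  \sum_(k < n.+1) n`!%:R * (bernoulli (n - k) / (n - k)`!%:R)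
                  * N%:R ^+ k.+1 / k.+1`!%:R.
Proof.
elim: N => [|N IHN].
  by rewrite big_ord0 big1 // => k _; rewrite expr0n mulr0 mul0r.
rewrite big_ord_recr /= {}IHN -natr1 addrC; apply/eqP; rewrite eq_sym -subr_eq.
apply/eqP; rewrite -sumrB.
pose b i : rat := bernoulli i / i`!%:R.
(* As [exp_sub1_coef] vanishes at 0, the terms with i > k are zero; [i] then runs over a range free
   of [k], and the sums can be exchanged. *)
transitivity (\sum_(k < n.+1) \sum_(i < n.+1)
    n`!%:R * (N%:R ^+ i / i`!%:R) * (b (n - k)%N * exp_sub1_coef (k.+1 - i))).
  apply: eq_bigr => k _.
  rewrite -/(b (n - k)%N) -mulrA -[X in _ - X]mulrA -mulrBr exp_taylor_shift.
  rewrite big_ord_recr /= subnn divr1 addrK mulr_sumr.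
  rewrite -(big_mkord xpredT (fun i => n`!%:R * b (n - k)%N *
    (N%:R ^+ i / i`!%:R / (k.+1 - i)`!%:R))).
  rewrite -(big_mkord xpredT (fun i => n`!%:R * (N%:R ^+ i / i`!%:R) *
    (b (n - k)%N * exp_sub1_coef (k.+1 - i)))).
  rewrite [RHS](big_cat_nat (n := k.+1)) ?ltn_ord //=.
  rewrite [X in _ = _ + X]big_nat_cond [X in _ = _ + X]big1 ?addr0; last first.
    move=> i /andP[/andP[ki _] _]; rewrite (_ : k.+1 - i = 0)%N ?mulr0 //.
    by apply/eqP; rewrite subn_eq0.
  apply: eq_big_nat => i /andP[_ ik].
  rewrite /exp_sub1_coef; case E: (k.+1 - i)%N => [|m]; last by ring.
  by move/eqP: E; rewrite subn_eq0 leqNgt ik.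
rewrite exchange_big /= (eq_bigr (fun i : 'I_n.+1 =>
  n`!%:R * (N%:R ^+ i / i`!%:R) * (n - i == 0)%N%:R)).
  rewrite big_ord_recr /= subnn mulr1 big1 ?add0r.
    by rewrite mulrCA divff ?mulr1 // factr_neq0.
  by move=> i _; rewrite subn_eq0 leqNgt ltn_ord mulr0.
move=> i _; rewrite -mulr_sumr; congr (_ * _).
rewrite (reindex_inj rev_ord_inj) /=.
have := bernoulli_generating_function (n - i).+1; rewrite eqSS => <-.
rewrite -(big_mkord xpredT (fun r => b (n - (n.+1 - r.+1))%N *
  exp_sub1_coef ((n.+1 - r.+1).+1 - i))).
rewrite -(big_mkord xpredT (fun r => b r * exp_sub1_coef ((n - i).+1 - r))).
rewrite [RHS]big_nat_recr //= subnn mulr0 addr0.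
have i_n : (i <= n)%N by rewrite -ltnS.
rewrite (big_cat_nat (n := (n - i).+1)) ?ltnS ?leq_subr //=.
rewrite [X in _ + X = _]big_nat_cond [X in _ + X = _]big1 ?addr0; last first.
  move=> r /andP[/andP[ri rn] _].
  by rewrite (_ : (n.+1 - r.+1).+1 - i = 0)%N ?mulr0 //; lia.
apply: eq_big_nat => r /andP[_ ri].
by congr (b _ * exp_sub1_coef _); lia.
Qed.

Section PowerSums.

Variable p : nat.
Hypothesis p_prime : prime p.

Let p_gt0 : (0 < p)%N. Proof. exact: prime_gt0. Qed.

Let pk_neq0 k : (p%:R ^+ k : rat) != 0.
Proof. by rewrite expf_neq0 // pnatr_eq0 -lt0n. Qed.

Lemma local_integral_scale (q : rat) : exists e : nat, local_dvd p 0 (p%:R ^+ e * q).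
Proof.
have den_gt0 : (0 < `|denq q|)%N by rewrite absz_gt0 denq_neq0.
exists (logn p `|denq q|); apply: (local_dvd_natM p_prime den_gt0); rewrite addn0.
have -> : (`|denq q|%N)%:R = (denq q)%:~R :> rat by rewrite pmulrn absz_denq.
by rewrite mulrCA (mulrC _ q) -numqE; exact: local_dvd_int.
Qed.

Lemma local_integral_scale_seq (c : nat -> rat) n :
  exists e : nat, forall k, (k < n)%N -> local_dvd p 0 (p%:R ^+ e * c k).
Proof.
elim: n => [|n [e IHn]]; first by exists 0%N.
have [e' He'] := local_integral_scale (c n); exists (e + e')%N => k.
rewrite ltnS leq_eqVlt exprD => /orP[/eqP->|/IHn Hk].
  by rewrite -mulrA; apply: local_dvdMl He'; rewrite -natrX; exact: local_dvd_natr.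
by rewrite mulrAC mulrC; apply: local_dvdMl Hk; rewrite -natrX; exact: local_dvd_natr.
Qed.

(** After division by p^M, the first Faulhaber term is [bernoulli n] and the others keep a factor
    p^M; [e] bounds the powers of [p] in their fixed denominators. *)
Lemma power_sum_limit n m : exists M0, forall M, (M0 <= M)%N ->
  local_dvd p m ((\sum_(j < p ^ M) (j%:R : rat) ^+ n) / p%:R ^+ M - bernoulli n).
Proof.
pose c k : rat := n`!%:R * (bernoulli (n - k.+1) / (n - k.+1)`!%:R) / k.+2`!%:R.
have [e He] := local_integral_scale_seq c n.
exists (m + e)%N => M leM.
set N := p%:R ^+ M.
have N_neq0 : N != 0 by exact: pk_neq0.
suff -> : (\sum_(j < p ^ M) (j%:R : rat) ^+ n) / N - bernoulli n =
    p%:R ^+ (M - e) * \sum_(k < n) ((p ^ M) ^ k)%N%:R * (p%:R ^+ e * c k).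
  have mM : (m <= M - e)%N by rewrite leq_subRL ?(leq_trans (leq_addl _ _) leM) // addnC.
  apply: (local_dvdW mM).
  apply: local_dvdMr; first exact: local_dvd_expp.
  apply: local_dvd_sum => k _; apply: local_dvdMl; first exact: local_dvd_natr.
  exact: He.
rewrite faulhaber big_ord_recl /= subn0 natrX -/N.
rewrite expr1 divr1 mulrCA divff ?factr_neq0 // mulr1 mulrDl mulfK //.
rewrite addrC addKr mulr_suml mulr_sumr; apply: eq_bigr => k _.
rewrite /bump /= add1n -/(c k) natrX natrX -/N.
rewrite [RHS](_ : _ = (p%:R ^+ (M - e) * p%:R ^+ e) * N ^+ k * c k); last by ring.
rewrite -exprD subnK ?(leq_trans (leq_addl _ _) leM) // -/N /c !exprS.
by field; rewrite !factr_neq0 N_neq0.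
Qed.

Lemma expr_first_order (x y : int) n :
  (y ^+ 2 %| (x + y) ^+ n.+1 - x ^+ n.+1 - n.+1%:R * y * x ^+ n)%Z.
Proof.
elim: n => [|n IHn]; first by rewrite [X in (_ %| X)%Z](_ : _ = 0) ?dvdz0 //; ring.
rewrite [X in (_ %| X)%Z](_ : _ =
  (x + y) * ((x + y) ^+ n.+1 - x ^+ n.+1 - n.+1%:R * y * x ^+ n)
  + y ^+ 2 * (n.+1%:R * x ^+ n)); last by rewrite -[n.+2%:R]natr1 !exprS; ring.
by apply: rpredD; [exact: dvdz_mull | exact: dvdz_mulr].
Qed.

Definition voronoi_sum (P : pred nat) (a n N : nat) : nat :=
  \sum_(j < N | P j) (a * j) ^ n * (a * j %/ N).

(** Multiplication by [a] permutes the residues modulo [N]. *)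
Lemma power_sum_mulmod a n N : coprime a N ->
  \sum_(j < N) ((a * j %% N)%N%:Z) ^+ n = \sum_(j < N) (j%:Z) ^+ n.
Proof.
move=> aN; have [N_gt0|] := ltnP 0 N; last first.
  by rewrite leqn0 => /eqP->; rewrite !big_ord0.
pose h (j : 'I_N) : 'I_N := Ordinal (ltn_pmod (a * j) N_gt0).
rewrite [RHS](reindex_inj (h := h)) // => i j /(congr1 val) /= /eqP.
wlog ij : i j / (j <= i)%N => [IH|].
  by case/orP: (leq_total j i) => ? /eqP H; [|symmetry]; apply: IH => //; apply/eqP.
rewrite eqn_mod_dvd ?leq_mul2l ?ij ?orbT // -mulnBr Gauss_dvdr; last first.
  by rewrite coprime_sym.
rewrite -eqn_mod_dvd // !modn_small ?ltn_ord // => /eqP; exact: val_inj.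
Qed.

(** Write a j mod N as a j - q N with q the floor of a j / N, expand its power to first order in q
    N, and sum over [j]. *)
Lemma voronoi a n N : coprime a N ->
  (N%:Z ^+ 2 %| (a%:Z ^+ n.+1 - 1) * (\sum_(j < N) (j%:Z) ^+ n.+1)
     - n.+1%:R * N%:Z * (voronoi_sum xpredT a n N)%:Z)%Z.
Proof.
move=> aN; rewrite mulrBl mul1r -[X in _ - X - _](power_sum_mulmod n.+1 aN).
rewrite mulr_sumr -sumrB -[(voronoi_sum _ _ _ _)%:Z]natz natr_sum mulr_sumr -sumrB.
apply: rpred_sum => j _; set q := (a * j %/ N)%N.
have def_r : (a * j %% N)%N%:Z = (a * j)%N%:Z + - (q%:Z * N%:Z).
  by rewrite {2}(divn_eq (a * j) N) -/q PoszD PoszM addrAC subrr add0r.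
have := expr_first_order (a * j)%N%:Z (- (q%:Z * N%:Z)) n; rewrite -def_r.
rewrite sqrrN exprMn => /dvdzP[z Hz]; apply/dvdzP; exists (- (z * q%:Z ^+ 2)).
rewrite mulNr -[z * _ * _]mulrA -Hz natrM natrX !natz PoszM !exprMn. ring.
Qed.

Lemma voronoi_sum_limit a n m : coprime a p -> exists M0, forall M, (M0 <= M)%N ->
  local_dvd p m ((voronoi_sum xpredT a n (p ^ M))%:R
                 - (a%:R ^+ n.+1 - 1) * bernoulli_hat n.+1).
Proof.
(* The extra [logn p n.+1] pays for the division by n + 1 in [bernoulli_hat]. *)
move=> ap; set m' := (logn p n.+1 + m)%N.
have [M0 HM0] := power_sum_limit n.+1 m'.
exists (M0 + m')%N => M leM.
apply: (local_dvd_natM p_prime (ltn0Sn n)); rewrite -/m'.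
have := voronoi n (coprimeXr M ap).
rewrite (_ : (p ^ M)%N%:Z ^+ 2 = p%:Z ^+ (M + M)); last first.
  by rewrite -[(p ^ M)%N%:Z]natz natrX natz exprD.
move/local_dvd_intE.
set V := voronoi_sum _ _ _ _; set S := \sum_(j < _) _.
have -> : ((a%:Z ^+ n.+1 - 1) * S - n.+1%:R * (p ^ M)%N%:Z * V%:Z)%:~R =
   p%:R ^+ M * ((a%:R ^+ n.+1 - 1) * (S%:~R / p%:R ^+ M) - n.+1%:R * V%:R) :> rat.
  rewrite rmorphB !rmorphM rmorphB rmorphXn /= -!pmulrn natrX.
  rewrite [n.+1%:R%:~R]rmorph_nat; have := pk_neq0 M; move: (p%:R ^+ M) => N N_neq0.
  by field.
have -> : S%:~R = \sum_(j < p ^ M) (j%:R : rat) ^+ n.+1.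
  rewrite rmorph_sum; apply: eq_bigr => j _; by rewrite rmorphXn /= -pmulrn.
set A := a%:R ^+ n.+1 - 1; set Q := _ / _ => /(local_dvd_pM p_prime) HV.
have HQ := HM0 M (leq_trans (leq_addr _ _) leM); rewrite -/Q in HQ.
have -> : n.+1%:R * (V%:R - A * bernoulli_hat n.+1) =
    A * (Q - bernoulli n.+1) - (A * Q - n.+1%:R * V%:R).
  by rewrite /bernoulli_hat; field; rewrite addrC natr1 pnatr_eq0.
apply: local_dvdB; last exact: local_dvdW (leq_trans (leq_addl _ _) leM) HV.
apply: local_dvdMl HQ; have := local_dvd_intr p (a%:Z ^+ n.+1 - 1).
by rewrite rmorphB rmorphXn /= -pmulrn.
Qed.

Lemma sum_multiples (f : nat -> nat) N :
  (\sum_(0 <= j < p * N | p %| j) f j = \sum_(0 <= i < N) f (p * i))%N.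
Proof.
elim: N => [|N IHN]; first by rewrite muln0 !big_geq.
rewrite mulnS addnC (big_cat_nat (n := (p * N)%N)) ?leq_addr //= IHN.
rewrite big_nat_recr //=; congr (_ + _)%N.
rewrite big_ltn_cond; last by rewrite -addn1 leq_add2l.
rewrite dvdn_mulr // big_nat_cond big1 ?addn0 // => i /andP[/andP[lti gti]].
move=> /dvdnP[k def_i]; move: lti gti.
by rewrite def_i addnC -mulnS [(k * p)%N]mulnC !ltn_pmul2l // => lti; rewrite ltnNge lti.
Qed.

(** For j = p i the floor of a j / p^(M+1) is that of a i / p^M, so the multiples of [p] reproduce
    the sum one level down, scaled by p^n. *)
Lemma voronoi_sum_coprime a n M :
  voronoi_sum xpredT a n (p ^ M.+1) =
  (voronoi_sum (fun j => ~~ (p %| j)%N) a n (p ^ M.+1)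
   + p ^ n * voronoi_sum xpredT a n (p ^ M))%N.
Proof.
rewrite /voronoi_sum.
pose f j := ((a * j) ^ n * (a * j %/ p ^ M.+1))%N.
rewrite (bigID (fun j : 'I_(p ^ M.+1) => p %| j)%N) /= addnC; congr (_ + _)%N.
rewrite -(big_mkord (fun j => p %| j)%N f) expnS sum_multiples big_mkord.
rewrite big_distrr /=; apply: eq_bigr => i _.
by rewrite /f mulnCA expnMn expnS divnMl // mulnA.
Qed.

(** Subtracting p^n times the sum at level M from the sum at level M + 1 creates the Euler factor 1
    - p^n. *)
Lemma zetap_voronoi a n m : coprime a p -> exists M0, forall M, (M0 <= M)%N ->
  local_dvd p m ((voronoi_sum (fun j => ~~ (p %| j)%N) a n (p ^ M))%:R
                 + (a%:R ^+ n.+1 - 1) * zetap_neg p n.+1).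
Proof.
move=> ap; have [M0 HM0] := voronoi_sum_limit n m ap.
exists M0.+1 => -[//|M]; rewrite ltnS => leM.
have H1 := HM0 M.+1 (leqW leM); have H0 := HM0 M leM.
move: H1; rewrite voronoi_sum_coprime natrD natrM natrX => H1.
set V := voronoi_sum xpredT _ _ _ in H0 H1.
rewrite /zetap_neg subn1 /=.
have {}H0 : local_dvd p m
    (p%:R ^+ n * (V%:R - (a%:R ^+ n.+1 - 1) * bernoulli_hat n.+1)).
  by apply: local_dvdMl H0; rewrite -natrX; exact: local_dvd_natr.
by have := local_dvdB H1 H0; congr (local_dvd p m _); ring.
Qed.

End PowerSums.

(** * Kummer congruences *)

Section Kummer.

Variable p : nat.
Hypothesis p_prime : prime p.

Let p_gt0 : (0 < p)%N. Proof. exact: prime_gt0. Qed.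

(** X^l - 1 has at most [l] roots in F_p, fewer than the p - 1 nonzero elements. *)
Lemma exists_power_not1 l : (0 < l < p.-1)%N ->
  exists2 b, coprime b p & b ^ l != 1 %[mod p].
Proof.
move=> /andP[l_gt0 l_lt].
case: (pickP (fun x : 'F_p => (x != 0) && (x ^+ l != 1))) => [x /andP[x0 xl]|no].
  exists x.
    rewrite coprime_sym prime_coprime // gtnNdvd ?lt0n //.
    by have := ltn_ord x; rewrite {2}Fp_cast.
  apply: contra xl => /eqP xl; apply/eqP.
  by rewrite -[x]natr_Zp -natrX -(Fp_nat_mod p_prime) xl Fp_nat_mod.
have := @max_unity_roots 'F_p l (enum [pred x : 'F_p | x != 0]) l_gt0.
rewrite enum_uniq -cardE (cardC1 (0 : 'F_p)) card_Fp // leqNgt l_lt.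
case/(_ _ isT)/negP => //; apply/allP => x; rewrite mem_enum inE => x0.
by apply/unity_rootP/eqP; have := no x; rewrite x0 /= => /negbFE.
Qed.

(* Replacing [b] by [b ^ (p ^ m)] makes [a ^ (p - 1)] trivial modulo [p ^ m]
   without changing [b] modulo [p]. *)
Lemma exists_approx_root_unity l m : (0 < l < p.-1)%N ->
  exists a, [/\ coprime a p, a ^ p.-1 = 1 %[mod p ^ m.+1]
              & a ^ l != 1 %[mod p]].
Proof.
move=> /exists_power_not1[b bp bl]; exists (b ^ (p ^ m))%N; split.
- exact: coprimeXl.
- rewrite -expnM mulnC -(totient_pfactor p_prime (ltn0Sn m)).
  exact: Euler_exp_totient (coprimeXr _ bp).
apply: contra bl => /eqP bl; apply/eqP; rewrite -bl.
rewrite -expnM mulnC expnM; elim: m {bl} => [|m IHm]; first by rewrite expn1.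
by rewrite expnSr expnM (fermat_little _ p_prime).
Qed.

(** As a^(p-1) = 1 mod p^(m+1), the factor a^n - 1 at n = l + (p-1) t may be replaced by the
    constant a^l - 1, and a Voronoi term depends on [t] only through the t-th power of (a j)^(p-1),
    which is 1 mod p. *)
Lemma zetap_exponential_sum l m T : (0 < l < p.-1)%N ->
  exists d N (c u : nat -> int), [/\ coprime d p, forall j, (p %| u j - 1)%Z
    & forall t, (t <= T)%N ->
      local_dvd p m (d%:R * zetap_neg p (l + (p - 1) * t)
                     - (\sum_(j < N) c j * u j ^+ t)%:~R)].
Proof.
move=> lp; have [a [ap a_p1 a_l]] := exists_approx_root_unity m lp.
have /andP[l_gt0 _] := lp.
have a_gt0 : (0 < a)%N.
  case: a ap {a_p1 a_l} => //; rewrite /coprime gcd0n => /eqP p1.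
  by move: p_prime; rewrite p1.
(* The level needed depends on [t]; the bound [T] makes a common one possible. *)
have [M HM] : exists M, forall t, (t <= T)%N -> local_dvd p m
   ((voronoi_sum (fun j => ~~ (p %| j)%N) a (l.-1 + p.-1 * t) (p ^ M))%:R
    + (a%:R ^+ (l + p.-1 * t) - 1) * zetap_neg p (l + p.-1 * t)).
  suff [M0 HM0] : exists M0, forall M, (M0 <= M)%N -> forall t, (t <= T)%N ->
    local_dvd p m
     ((voronoi_sum (fun j => ~~ (p %| j)%N) a (l.-1 + p.-1 * t) (p ^ M))%:R
      + (a%:R ^+ (l + p.-1 * t) - 1) * zetap_neg p (l + p.-1 * t)).
    by exists M0; exact: HM0.
  elim: T => [|T [M1 HM1]].
    have [M0 HM0] := zetap_voronoi p_prime l.-1 m ap.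
    exists M0 => M leM t; rewrite leqn0 => /eqP->; rewrite muln0 !addn0.
    by have := HM0 _ leM; rewrite prednK.
  have [M0 HM0] := zetap_voronoi p_prime (l.-1 + p.-1 * T.+1) m ap.
  exists (M0 + M1)%N => M leM t; rewrite leq_eqVlt => /orP[/eqP->|/HM1]; last first.
    by apply; exact: leq_trans (leq_addl _ _) leM.
  have := HM0 _ (leq_trans (leq_addr _ _) leM).
  by rewrite -addSn prednK.
have a_t t : a ^ (l + p.-1 * t) = a ^ l %[mod p ^ m.+1].
  by rewrite expnD expnM -modnMmr -modnXm a_p1 modnXm exp1n modnMmr muln1.
have cop e : (a ^ e != 1 %[mod p])%N -> coprime (a ^ e - 1) p.
  rewrite coprime_sym prime_coprime // => H; apply: contra H.
  by rewrite eqn_mod_dvd // expn_gt0 a_gt0.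
exists (a ^ l - 1)%N, (p ^ M)%N,
  (fun j => if (p %| j)%N then 0 else - ((a * j) ^ l.-1 * (a * j %/ p ^ M))%N%:Z),
  (fun j => if (p %| j)%N then 1 else ((a * j) ^ p.-1)%N%:Z); split.
- exact: cop.
- move=> j; case: ifP => [_|/negbT pj]; first by rewrite subrr.
  rewrite -eqz_mod_dvd !modz_nat eqz_nat -totient_prime //.
  apply/eqP/Euler_exp_totient; rewrite coprimeMl ap.
  by rewrite coprime_sym prime_coprime.
move=> t /HM; rewrite (subn1 p); set F := zetap_neg _ _.
set V := voronoi_sum _ _ _ _ => HV.
(* Since a^n - 1 is prime to [p], [F] is [p]-integral, so the error (a^n - a^l) F made below stays
   divisible by p^m. *)
have intF : local_dvd p 0 F.
  apply: (@local_dvd_unit _ _ (a ^ (l + p.-1 * t) - 1)%N).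
    apply: cop; apply: contra a_l => /eqP a1.
    apply/eqP; rewrite -a1; apply/esym.
    have := congr1 (modn^~ p) (a_t t).
    by rewrite !modn_dvdm // expnS dvdn_mulr.
  rewrite natrB ?expn_gt0 ?a_gt0 // natrX.
  have := local_dvdB (local_dvdW (leq0n m) HV) (local_dvd_natr p V).
  by rewrite addrAC subrr add0r.
have -> : (\sum_(j < p ^ M) (if (p %| j)%N then 0 else
     - ((a * j) ^ l.-1 * (a * j %/ p ^ M))%N%:Z)
     * (if (p %| j)%N then 1 else ((a * j) ^ p.-1)%N%:Z) ^+ t)%:~R = - V%:R :> rat.
  rewrite /V /voronoi_sum natr_sum rmorph_sum -sumrN [RHS]big_mkcond /=.
  apply: eq_bigr => j _; case: ifP => _ /=; first by rewrite mul0r.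
  rewrite rmorphM rmorphXn rmorphN /= -!pmulrn expnD expnM !natrM !natrX; ring.
rewrite natrB ?expn_gt0 ?a_gt0 // natrX.
have Ha : local_dvd p m ((a ^ (l + p.-1 * t))%:R - (a ^ l)%:R).
  by apply: local_dvdW (leqnSn m) _; apply/local_dvd_natE.
have := local_dvdB HV (local_dvdMr Ha intF).
by rewrite !natrX; congr (local_dvd p m _); ring.
Qed.

Hypothesis p_odd : odd p.

Lemma expr1D_third_order (x : int) n :
  (x ^+ 3 %| (1 + x) ^+ n - 1 - n%:R * x - 'C(n, 2)%:R * x ^+ 2)%Z.
Proof.
elim: n => [|n /dvdzP[z Hz]]; first by rewrite bin0n /= subrr !mul0r !subr0 dvdz0.
apply/dvdzP; exists ((1 + x) * z + 'C(n, 2)%:R).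
rewrite mulrDl -[_ * z * _]mulrA -Hz binS bin1 natrD exprS -natr1; ring.
Qed.

(** Repeated p-th powers. As [p] is odd, it divides the binomial coefficient C(p,2), which gives the
    quadratic term the power of [p] it needs. *)
Lemma expr_pfactor_1mod (x : int) v : exists z : int,
  (1 + p%:Z * x) ^+ (p ^ v) = 1 + p%:Z ^+ v * (p%:Z * x + p%:Z ^+ 2 * z).
Proof.
elim: v => [|v [z IHv]]; first by exists 0; rewrite expn0 expr0 expr1; ring.
set y := p%:Z * x + _ in IHv; rewrite expnSr exprM IHv.
have /dvdzP[w] := expr1D_third_order (p%:Z ^+ v * y) p.
have -> : 'C(p, 2)%:R = p%:Z * p.-1./2%:R.
  by rewrite bin2odd // natrM natz.
move=> /(canRL (subrK _))/(canRL (subrK _))/(canRL (subrK _)) ->.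
exists (z + p.-1./2%:R * p%:Z ^+ v * (x + p%:Z * z) ^+ 2
   + w * p%:Z ^+ v * p%:Z ^+ v * (x + p%:Z * z) ^+ 3).
rewrite (natz p) (exprS _ v) /y; ring.
Qed.

(** For k = j p^v, u^k is (1 + p^v y)^j with [y] divisible by [p], and the terms beyond the linear
    one vanish mod p^(v+2). *)
Lemma expr_1mod (u : int) v k : (p %| u - 1)%Z -> (p ^ v %| k)%N ->
  (p%:Z ^+ v.+2 %| u ^+ k - 1 - k%:R * (u - 1))%Z.
Proof.
move=> /dvdzP[x def_x] /dvdnP[j ->].
have -> : u = 1 + p%:Z * x by rewrite mulrC -def_x addrC subrK.
have [z Hz] := expr_pfactor_1mod x v.
rewrite mulnC exprM Hz; set y := p%:Z * x + _.
have /dvdzP[w] := expr1D_third_order (p%:Z ^+ v * y) j.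
move=> /(canRL (subrK _))/(canRL (subrK _))/(canRL (subrK _)) ->.
apply/dvdzP; exists (j%:R * z + p%:Z ^+ v * (x + p%:Z * z) ^+ 2 *
   ('C(j, 2)%:R + w * (p%:Z ^+ v * y))).
rewrite natrM natrX (natz p) !exprS /y; ring.
Qed.

(** The common factor u^t is 1 mod p, while k (u - 1) is already divisible by p^(v+1). *)
Lemma expr_1mod_diff (u : int) v k t : (p %| u - 1)%Z -> (p ^ v %| k)%N ->
  (p%:Z ^+ v.+2 %| u ^+ (t + k) - u ^+ t - k%:R * (u - 1))%Z.
Proof.
move=> u1 vk; have /dvdzP[x def_x] := u1; have /dvdnP[j def_k] := vk.
have /dvdzP[w Hw] : (p %| u ^+ t - 1)%Z by rewrite subrX1 dvdz_mulr.
rewrite [X in (_ %| X)%Z](_ : _ = u ^+ t * (u ^+ k - 1 - k%:R * (u - 1))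
   + p%:Z ^+ v.+2 * (j%:R * x * w)).
  apply: rpredD; last exact: dvdz_mulr.
  by apply: dvdz_mull; exact: expr_1mod.
have -> : u ^+ t * (u ^+ k - 1 - k%:R * (u - 1)) = u ^+ t * u ^+ k - u ^+ t
   - k%:R * (u - 1) - (u ^+ t - 1) * (k%:R * (u - 1)) by ring.
by rewrite Hw def_x exprD def_k natrM natrX (natz p) !exprS; ring.
Qed.

(** The congruence for a single exponential passes to integral combinations, and the [p]-unit [d]
    cancels. *)
Lemma zetap_kummer l t k v : (0 < l < p.-1)%N -> (p ^ v %| k)%N ->
  let F t := zetap_neg p (l + (p - 1) * t) in
  local_dvd p v.+2 (F (t + k)%N - F t - k%:R * (F 1%N - F 0%N)).
Proof.
move=> lp vk F.
(* The bound t + k + 1 covers the index 1 even when t = k = 0. *)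
have [d [N [c [u [dp u1 Hd]]]]] := zetap_exponential_sum v.+2 (t + k).+1 lp.
apply: (local_dvd_unit dp).
pose G t := \sum_(j < N) c j * u j ^+ t.
have HG i : (i <= (t + k).+1)%N -> local_dvd p v.+2 (d%:R * F i - (G i)%:~R).
  exact: Hd.
have HGG : local_dvd p v.+2 (G (t + k)%N - G t - k%:R * (G 1%N - G 0%N))%:~R.
  apply/local_dvd_intE.
  rewrite /G mulrBr !mulr_sumr -!sumrB; apply: rpred_sum => j _.
  have := dvdz_mull (c j) (expr_1mod_diff t (u1 j) vk).
  by congr (_ %| _)%Z; rewrite expr1 expr0; ring.
apply: local_dvd_congr HGG.
have h1 := HG (t + k)%N (leqnSn _).
have h2 := HG t (leqW (leq_addr _ _)).
have h3 := local_dvdMl (local_dvd_natr p k) (local_dvdB (HG 1%N isT) (HG 0%N isT)).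
have := local_dvdB (local_dvdB h1 h2) h3; congr (local_dvd p _ _).
by rewrite !rmorphB rmorphM /= rmorphB /= rmorph_nat; ring.
Qed.

End Kummer.

(** * Zeros of functions that are linear to first order *)

Section LinearMod.

Variables (p d : nat) (F : nat -> rat).
Hypotheses (p_prime : prime p) (d_p : coprime d p).
Hypothesis F_linear : forall t k v, (p ^ v %| k)%N ->
  local_dvd p v.+2 (F (t + k)%N - F t + k%:R * (p%:R * d%:R)).

Let p_gt0 : (0 < p)%N. Proof. exact: prime_gt0. Qed.

(** The slope -p d provides one more power of [p] than t - t' does. *)
Lemma linear_mod_continuous t t' k :
  t = t' %[mod p ^ k] -> local_dvd p k.+1 (F t - F t').
Proof.
wlog le_t : t t' / (t' <= t)%N => [IH tt'|].
  case/orP: (leq_total t' t) => le_t; first exact: IH.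
  by rewrite -opprB; apply/local_dvdN/IH.
move=> /eqP; rewrite eqn_mod_dvd // => dvd_t.
have := F_linear t' dvd_t; rewrite subnKC // => /(local_dvdW (leqnSn _)) H.
rewrite -[X in local_dvd p _ X](addrK ((t - t')%:R * (p%:R * d%:R))).
apply: (local_dvdB H); have /dvdnP[j ->] := dvd_t.
rewrite [X in local_dvd p _ X](_ : _ = p%:R ^+ k.+1 * (j * d)%:R).
  exact: local_dvdMr (local_dvd_expp _ _) (local_dvd_natr _ _).
by rewrite !natrM natrX exprS; ring.
Qed.

(** Digit by digit: if t = t' mod p^n and both values vanish mod p^(n+2), then so does (t - t') p d,
    where [p] and [d] cancel. *)
Lemma linear_mod_zero_unique n t t' : local_dvd p n.+1 (F t) ->
  local_dvd p n.+1 (F t') -> t = t' %[mod p ^ n].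
Proof.
wlog le_t : t t' / (t' <= t)%N => [IH|].
  by case/orP: (leq_total t' t) => /IH H h1 h2; [|symmetry]; exact: H.
elim: n => [|n IHn] Ft Ft'; first by rewrite expn0 !modn1.
have /eqP := IHn (local_dvdW (leqnSn _) Ft) (local_dvdW (leqnSn _) Ft').
rewrite eqn_mod_dvd // => dvd_t.
have := local_dvdB (F_linear t' dvd_t) (local_dvdB Ft Ft').
rewrite subnKC // addrAC subrr add0r mulrCA -natrM => /(@local_dvd_pM _ p_prime 1).
move/local_dvd_natrE.
rewrite Gauss_dvdl ?coprimeXl // 1?coprime_sym // => dvd_t'.
by apply/eqP; rewrite eqn_mod_dvd.
Qed.

(** [s] is the residue of [z * u], where Bezout's [u] inverts [e] modulo [p]. *)
Lemma linear_congruence (z : int) e : coprime e p ->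
  exists2 s, (s < p)%N & (p %| z - (s * e)%N%:Z)%Z.
Proof.
move=> ep; have [[u v] /= Huv] : exists uv : int * int, uv.1 * e%:Z + uv.2 * p%:Z = 1.
  have /eqP/= := ep; rewrite -[gcdn e p]/(`|gcdz e p|)%N.
  have [u [v]] := Bezoutz e p; rewrite /gcdz /= => Huv ep1.
  by exists (u, v); rewrite /= Huv ep1.
have p_neq0 : p%:Z != 0 by rewrite eqz_nat -lt0n.
have := divz_eq (z * u) p; have := modz_ge0 (z * u) p_neq0.
have := ltz_pmod (z * u) (p_gt0 : (0 < p%:Z)).
case: (_ %% _)%Z => // s; rewrite ltz_nat => sp _ def_zu; exists s => //.
apply/dvdzP; exists (z * v + (z * u %/ p)%Z * e%:Z).
rewrite PoszM -{1}[z]mulr1 -Huv.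
have -> : s%:Z = z * u - (z * u %/ p)%Z * p by rewrite {1}def_zu addrAC subrr add0r.
ring.
Qed.

(** This is the Hensel step: with F(t) = p^(n+1) z / e, the new value is p^(n+1) (z - s d e) / e
    modulo p^(n+2), so [s] solves a linear congruence mod p. *)
Lemma linear_mod_lift n t : local_dvd p n.+1 (F t) ->
  exists2 s, (s < p)%N & local_dvd p n.+2 (F (t + s * p ^ n)%N).
Proof.
move=> [e [z ep def_z]].
have de_p : coprime (d * e) p by rewrite coprimeMl d_p.
have [s sp /dvdzP[y def_y]] := linear_congruence z de_p.
exists s => //.
have HF := F_linear t (dvdn_mull s (dvdnn (p ^ n)%N)).
apply: (@local_dvd_congr _ _ _ (F t - (s * p ^ n)%:R * (p%:R * d%:R))).
  by have := HF; congr (local_dvd p _ _); ring.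
apply: (local_dvd_unit ep); exists 1%N, y.
  exact: coprime1n.
have {}def_y : z%:~R = y%:~R * p%:R + s%:R * (d%:R * e%:R) :> rat.
  by rewrite -!natrM (pmulrn _ p) (pmulrn _ (s * _)) -rmorphM -rmorphD -def_y subrK.
rewrite mul1r mulrBr def_z def_y natrM natrX !exprS; ring.
Qed.

Lemma linear_mod_digits : local_dvd p 1 (F 0%N) -> exists2 g : nat -> nat,
  forall i, (g i < p)%N
  & forall n, local_dvd p n.+1 (F (\sum_(0 <= i < n) g i * p ^ i)%N).
Proof.
move=> F0.
(* The implication makes the relation total, as choice demands; 0 is a default digit where F(t) is
   not divisible by p^(n+1). *)
have /choice[h Hh] : forall nt : nat * nat, exists s, (s < p)%N /\
    (local_dvd p nt.1.+1 (F nt.2) -> local_dvd p nt.1.+2 (F (nt.2 + s * p ^ nt.1)%N)).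
  move=> [n t] /=.
  have [/linear_mod_lift[s sp Fs]|nF] := pselect (local_dvd p n.+1 (F t)).
    by exists s.
  by exists 0%N.
pose fix T n := if n is n'.+1 then (T n' + h (n', T n') * p ^ n')%N else 0%N.
exists (fun i => h (i, T i)) => [i|n]; first by have [] := Hh (i, T i).
have -> : (\sum_(0 <= i < n) h (i, T i) * p ^ i)%N = T n.
  by elim: n => [|n IHn]; [rewrite big_geq | rewrite big_nat_recr //= IHn].
by elim: n => // n IHn; have [_] := Hh (n, T n); exact.
Qed.

End LinearMod.

(** * Limits and digit expansions in Z_p *)

Section PadicLimits.

Variable p : nat.
Hypothesis p_prime : prime p.

Let p_gt0 : (0 < p)%N. Proof. exact: prime_gt0. Qed.

Lemma residue_mod (x : padic_int p) i k : (k <= i)%N ->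
  residue x i = residue x k %[mod p ^ k].
Proof.
elim: i => [|i IHi]; first by rewrite leqn0 => /eqP->.
rewrite leq_eqVlt => /orP[/eqP->//|ki]; rewrite -IHi // [residue x i]residue_compat.
by rewrite modn_dvdm // dvdn_exp2l.
Qed.

Lemma padic_cvg_local_dvd u (x : padic_int p) k : padic_cvg u x ->
  exists N, forall i, (N <= i)%N -> local_dvd p k.+1 (u i - (residue x k.+1)%:R).
Proof. by move=> /(_ k.+1)[N HN]; exists N => i /HN; exact: dvdq_local_dvd. Qed.

Lemma padic_cvg_mod (t : nat -> nat) (x : padic_int p) k :
  padic_cvg (fun i => (t i)%:R) x ->
  exists N, forall i, (N <= i)%N -> t i = residue x k %[mod p ^ k].
Proof.
case: k => [|k]; first by exists 0%N => i _; rewrite expn0 !modn1.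
by move=> /padic_cvg_local_dvd-/(_ k)[N HN]; exists N => i /HN/local_dvd_natE.
Qed.

Lemma padic_cvg_residue (x : padic_int p) :
  padic_cvg (fun i => (residue x i)%:R) x.
Proof.
by move=> k; exists k => i ki; apply/local_dvd_dvdq/local_dvd_natE/residue_mod.
Qed.

Lemma padic_int_mod_inj (x y : padic_int p) :
  (forall k, residue x k = residue y k %[mod p ^ k]) -> x = y.
Proof.
move=> xy; apply: padic_int_ext => k; have := xy k.
by rewrite !modn_small ?residue_lt.
Qed.

Lemma padic_cvg_unique u (x y : padic_int p) :
  padic_cvg u x -> padic_cvg u y -> x = y.
Proof.
move=> ux uy; apply: padic_int_mod_inj => -[|k]; first by rewrite expn0 !modn1.
have [N HN] := padic_cvg_local_dvd k ux; have [M HM] := padic_cvg_local_dvd k uy.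
have := local_dvdB (HM _ (leq_addl N M)) (HN _ (leq_addr M N)).
set v := u _; rewrite [X in local_dvd p _ X](_ : _ =
  (residue x k.+1)%:R - (residue y k.+1)%:R); last by ring.
by move/local_dvd_natE.
Qed.

Lemma padic_cvg0 u : (forall k, exists N, forall i, (N <= i)%N -> local_dvd p k (u i)) ->
  padic_cvg u (padic_of_nat p 0).
Proof.
move=> u0 k; have [N HN] := u0 k; exists N => i /HN; rewrite /= mod0n subr0.
exact: local_dvd_dvdq.
Qed.

Lemma padic_cvg0_local_dvd u k : padic_cvg u (padic_of_nat p 0) ->
  exists N, forall i, (N <= i)%N -> local_dvd p k.+1 (u i).
Proof.
move=> /padic_cvg_local_dvd-/(_ k)[N HN]; exists N => i /HN.
by rewrite /= mod0n subr0.
Qed.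

Lemma padic_of_nat1_neq0 : padic_of_nat p 1 <> padic_of_nat p 0.
Proof.
move=> /(congr1 (fun x => residue x 1)) /=.
by rewrite expn1 mod0n modn_small // prime_gt1.
Qed.

Lemma chi_partial_sumS s m :
  chi_partial_sum p s m.+1 = (chi_partial_sum p s m + s m.+2 * p ^ m)%N.
Proof. by rewrite /chi_partial_sum big_nat_recr. Qed.

Lemma chi_partial_sum_lt s m : (forall nu, (s nu.+2 < p)%N) ->
  (chi_partial_sum p s m < p ^ m)%N.
Proof.
move=> sp; elim: m => [|m IHm]; first by rewrite /chi_partial_sum big_geq.
rewrite chi_partial_sumS expnS; apply: leq_trans (_ : (s m.+2).+1 * p ^ m <= _)%N.
  by rewrite mulSn ltn_add2r.
by rewrite leq_mul2r sp orbT.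
Qed.

(** A partial sum of [m] digits is below p^m, so the partial sums are themselves the residues of the
    limit. *)
Lemma padic_of_digits s : (forall nu, (s nu.+2 < p)%N) -> exists x : padic_int p,
  padic_cvg (fun m => (chi_partial_sum p s m)%:R) x.
Proof.
move=> sp.
have compat m : chi_partial_sum p s m = (chi_partial_sum p s m.+1 %% p ^ m)%N.
  by rewrite chi_partial_sumS addnC modnMDl modn_small ?chi_partial_sum_lt.
by exists (PadicInt compat); exact: (padic_cvg_residue (PadicInt compat)).
Qed.

End PadicLimits.

(** A nonzero value cannot be the default of [xget], so it has the defining property. *)
Lemma DeltaP p l : Delta p l <> 0%N -> (Delta p l < p)%N /\
  dvdq p (p%:R^-1 * (bernoulli_hat (l + p - 1) - bernoulli_hat l) - (Delta p l)%:R).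
Proof. by rewrite /Delta; case: xgetP. Qed.

(** The Euler factor 1 - p^(n-1) is a [p]-unit for n > 1. *)
Lemma zetap_neg_local_dvd p k n : prime p -> (1 < n)%N ->
  local_dvd p k (zetap_neg p n) <-> local_dvd p k (bernoulli_hat n).
Proof.
move=> p_prime n_gt1; have p_gt0 := prime_gt0 p_prime.
have -> : zetap_neg p n = (p ^ (n - 1) - 1)%N%:R * bernoulli_hat n.
  by rewrite natrB ?expn_gt0 ?p_gt0 // natrX /zetap_neg; ring.
split=> [|Hn]; last exact: local_dvdMl (local_dvd_natr _ _) Hn.
apply: local_dvd_unit; rewrite coprime_sym prime_coprime //.
have p_dvd : (p %| p ^ (n - 1))%N by rewrite dvdn_exp // subn_gt0.
by rewrite dvdn_subr ?expn_gt0 ?p_gt0 // dvdn1 neq_ltn prime_gt1 ?orbT.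
Qed.

(** * The zero of the p-adic zeta function *)

Section ZetaZero.

Variables p l : nat.
Hypotheses (p_prime : prime p) (p_odd : odd p) (l_even : ~~ odd l).
Hypotheses (l_gt1 : (1 < l)%N) (l_lt : (l < p.-1)%N).
Hypothesis irr_pl : local_dvd p 1 (bernoulli_hat l).
Hypothesis Delta_neq0 : Delta p l <> 0%N.

Let p_gt0 : (0 < p)%N. Proof. exact: prime_gt0. Qed.

Let F t := zetap_neg p (l + (p - 1) * t).

Let idx_gt1 t : (1 < l + (p - 1) * t)%N.
Proof. exact: leq_trans (leq_addr _ _). Qed.

(** [Delta] compares values of [bernoulli_hat]; the Euler corrections p^(n-1) B_n/n vanish mod p^2,
    since [p] divides B_n/n at both indices. *)
Lemma zetap_slope :
  local_dvd p 2 (F 1%N - F 0%N + p%:R * (Delta p l)%:R).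
Proof.
have [_] := DeltaP Delta_neq0; rewrite -{1}(expn1 p) => /dvdq_local_dvd.
set B1 := bernoulli_hat (l + p - 1); set B0 := bernoulli_hat l.
set D : rat := (Delta p l)%:R => /(_ isT) H.
have p_neq0 : (p%:R : rat) != 0 by rewrite pnatr_eq0 -lt0n.
have H2 : local_dvd p 2 (B1 - B0 - p%:R * D).
  have := local_dvdM (local_dvd_expp p 1) H; congr (local_dvd p _ _).
  by field.
have B1_dvd : local_dvd p 1 B1.
  have := local_dvdD (local_dvdD (local_dvdW (leqnSn _) H2) irr_pl)
            (local_dvdMr (local_dvd_expp p 1) (local_dvd_natr p (Delta p l))).
  by congr (local_dvd p _ _); rewrite -/B0 -/D; ring.
have euler_factor n (B : rat) : (1 < n)%N -> local_dvd p 1 B ->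
    local_dvd p 2 (p%:R ^+ (n - 1) * B).
  move=> n_gt1 HB; apply: (@local_dvdM _ 1 1) HB.
  by apply: local_dvdW (local_dvd_expp _ _); rewrite subn_gt0.
have E1 : (l + (p - 1) * 1 = l + p - 1)%N by rewrite muln1 addnBA.
have l1_gt1 : (1 < l + p - 1)%N by rewrite -E1.
have := local_dvdB (local_dvdB (euler_factor _ _ l1_gt1 B1_dvd)
          (euler_factor _ _ l_gt1 irr_pl)) H2.
congr (local_dvd p _ _).
by rewrite /F E1 muln0 addn0 /zetap_neg -/B1 -/B0; ring.
Qed.

Lemma Delta_coprime : coprime (Delta p l) p.
Proof.
have [lt_p _] := DeltaP Delta_neq0.
rewrite coprime_sym prime_coprime // gtnNdvd // lt0n; exact/eqP.
Qed.

(** This supplies the hypothesis [F_linear], with [Delta p l] as the unit [d]. *)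
Lemma zetap_linear t k v : (p ^ v %| k)%N ->
  local_dvd p v.+2 (F (t + k)%N - F t + k%:R * (p%:R * (Delta p l)%:R)).
Proof.
move=> vk; have l_bounds : (0 < l < p.-1)%N by rewrite (ltnW l_gt1).
have := local_dvdM (proj2 (local_dvd_natrE _ _ _) vk) zetap_slope; rewrite addn2.
move/(local_dvdD (zetap_kummer p_prime p_odd t l_bounds vk)).
by congr (local_dvd p _ _); rewrite -/(F _) -/(F _); ring.
Qed.

(** The digits found by Hensel lifting satisfy [chi_digits], so [chi p l] is not a default value. *)
Lemma chi_spec : exists s, chi_digits p l s /\
  padic_cvg (fun m => (chi_partial_sum p s m)%:R) (chi p l).
Proof.
have F0 : local_dvd p 1 (F 0%N).
  by apply/(zetap_neg_local_dvd _ p_prime) => //; rewrite muln0 addn0.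
have [g gp Fg] := linear_mod_digits p_prime Delta_coprime zetap_linear F0.
pose s nu := g (nu - 2)%N.
have s_sum m : chi_partial_sum p s m = (\sum_(0 <= i < m) g i * p ^ i)%N.
  by apply: eq_bigr => i _; rewrite /s subn2.
have s_lt nu : (s nu.+2 < p)%N by exact: gp.
have [x x_lim] := padic_of_digits s_lt.
suff s_digits : chi_digits p l s.
  by rewrite /chi; case: xgetP => [y _ //|/(_ x)[]]; exists s.
split=> [nu _|[//|n] _]; first exact: gp.
rewrite subSS subn0 inE /= p_prime p_odd oddD oddM oddB ?prime_gt0 // p_odd /=.
rewrite addbF l_even idx_gt1 /=; apply/andP; split.
  (* From l < p - 1 and T < p^n follows l + (p-1) T < (p-1)(T+1) <= (p-1) p^n. *)
  rewrite totient_pfactor //= -subn1.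
  have := chi_partial_sum_lt n s_lt.
  move: (chi_partial_sum p s n) => T; rewrite -(leq_pmul2l (_ : 0 < p - 1)%N).
    by apply: leq_trans; rewrite mulnS ltn_add2r subn1.
  by rewrite subn_gt0 prime_gt1.
apply: local_dvd_dvdq; apply/(zetap_neg_local_dvd _ p_prime) => //.
by rewrite s_sum; exact: Fg.
Qed.

Lemma chi_digits_zero s n : chi_digits p l s ->
  local_dvd p n.+1 (F (chi_partial_sum p s n)).
Proof.
move=> [_ /(_ n.+1 isT)]; rewrite subSS subn0 inE /=.
case/and5P=> _ _ _ _ /andP[_ /dvdq_local_dvd-/(_ isT) H].
exact/(zetap_neg_local_dvd _ p_prime).
Qed.

(** Modulo p^k the sequence eventually agrees with the partial sums of the digits, where [F] is
    small; continuity of [F] concludes. Thus the limit defining the zeta value at [chi p l]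
    exists. *)
Lemma zetap_cvg_chi (t : nat -> nat) : padic_cvg (fun i => (t i)%:R) (chi p l) ->
  padic_cvg (fun i => F (t i)) (padic_of_nat p 0).
Proof.
have [s [s_digits s_lim]] := chi_spec.
move=> t_lim; apply: padic_cvg0 => k.
have [N HN] := padic_cvg_mod k t_lim.
have [M HM] := padic_cvg_mod k s_lim.
exists N => i /HN; rewrite -(HM _ (leq_addl k M)).
move/(linear_mod_continuous zetap_linear)/(local_dvdW (leqnSn _))/local_dvd_congr.
apply; apply: local_dvdW (chi_digits_zero (k + M) s_digits).
by rewrite (leq_trans (leq_addr M k)).
Qed.

(** Late residues of [x] and late partial sums of the digits are zeros of [F] mod p^(k+1), so they
    agree mod p^k. *)
Lemma zetap_cvg0_unique (x : padic_int p) :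
  padic_cvg (fun i => F (residue x i)) (padic_of_nat p 0) -> x = chi p l.
Proof.
have [s [s_digits s_lim]] := chi_spec.
move=> Fx; apply: padic_int_mod_inj => // k.
have [N HN] := padic_cvg0_local_dvd k Fx.
have [M HM] := padic_cvg_mod k s_lim.
rewrite -(HM _ (leq_addl k M)) -(residue_mod x (leq_addl N k)).
apply: (linear_mod_zero_unique p_prime Delta_coprime zetap_linear).
  exact: HN (leq_addr _ _).
by apply: local_dvdW (chi_digits_zero (k + M) s_digits); rewrite ltnS leq_addr.
Qed.

End ZetaZero.

Theorem theorem4p6 (p l : nat) (hpl : (p, l) \in Psi_irr 1)
    (hDelta : Delta p l <> 0%N) :
  padic_zeta p l (chi p l) = padic_of_nat p 0 /\
  (forall s : padic_int p, padic_zeta p l s = padic_of_nat p 0 -> s = chi p l).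
Proof.
have := hpl; rewrite inE /= expn1.
case/and5P=> p_prime p_odd l_even l_gt1 /andP[l_lt].
rewrite totient_prime // in l_lt.
rewrite -{1}(expn1 p) => /dvdq_local_dvd-/(_ isT) irr_pl.
have chi0 := zetap_cvg_chi p_prime p_odd l_even l_gt1 l_lt irr_pl hDelta.
split=> [|s].
  have [s [_ s_lim]] := chi_spec p_prime p_odd l_even l_gt1 l_lt irr_pl hDelta.
  (* The candidate 0 excludes the default; any candidate equals 0, as testing on the partial sums of
     the digits shows. *)
  rewrite /padic_zeta; case: xgetP => [y _ Hy|/(_ (padic_of_nat p 0))[] //].
  have y_lim := Hy _ s_lim; have zero_lim := chi0 _ s_lim.
  exact: (padic_cvg_unique p_prime y_lim zero_lim).
(* The default 1 is not a zero, so the value is a true limit and can be tested on the residues of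
   [s]. *)
rewrite /padic_zeta; case: xgetP => [y _ Hy y0|_ /padic_of_nat1_neq0 //].
apply: zetap_cvg0_unique => //; rewrite -y0.
exact: Hy _ (padic_cvg_residue s).
Qed.
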